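(* Let $\mathbb K$ be a field, $\mathcal K=(\partial:H\to G)$ a crossed module, and $A$ a weak $\mathcal K$-algebra over $\mathbb K$ with structure $(\omega_1,\omega_2,\omega_3)$. Then the following data define a unital 2-module $\Theta_A:\widetilde{\mathcal K}\to2\text{-}\mathcal Aut(A\text{-Mod})$: $$\Theta_A(\star)=A\text{-Mod},\quad \Theta_A(\mathbf g)=[\omega_1(\mathbf g)],\quad \Theta_A(\mathbf g\stackrel{x}{\Rightarrow}\partial(x)\mathbf g)=\Upsilon\big(\omega_3(\partial x,\mathbf g)\,\omega_2(x)\big)\quad(\mathbf g\in G,\ x\in H),$$ with unit constraint $\Theta^2_{A\,\star}=\mathrm{Id}$ and composition constraints $\Theta_A^2(\mathbf f,\mathbf g)=\Upsilon(\omega_3(\mathbf f,\mathbf g)):\Theta_A(\mathbf f)\diamond\Theta_A(\mathbf g)\Rightarrow\Theta_A(\mathbf f\mathbf g)$ for $\mathbf f,\mathbf g\in G$. If $A$ is a $\mathcal K$-algebra (i.e. $\omega_3\equiv1$), then $\Theta_A$ is a strict 2-module.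
   Context: A crossed module $\mathcal K=(\partial:H\to G)$ is a group homomorphism with a left action of $G$ on $H$ by automorphisms, $\partial({}^{\mathbf g}h)=\mathbf g\partial(h)\mathbf g^{-1}$, ${}^{\partial(h)}h'=hh'h^{-1}$. The 2-group $\widetilde{\mathcal K}$ is the 2-category with one object $\star$, 1-morphisms $\mathbf g\in G$, $\mathbf f\diamond\mathbf g=\mathbf f\mathbf g$, 2-morphisms $\mathbf g\stackrel{h}{\Rightarrow}\partial(h)\mathbf g$ ($h\in H$), vertical composition $h_2\circ h_1=h_2h_1$, and $[\mathbf f\stackrel{h}{\Rightarrow}\mathbf g]\diamond[\mathbf f_1\stackrel{h_1}{\Rightarrow}\mathbf g_1]=[\mathbf f\mathbf f_1\stackrel{h\,{}^{\mathbf f}h_1}{\Longrightarrow}\mathbf g\mathbf g_1]$. For an associative unital algebra $A$, a weak $\mathcal K$-algebra structure (weak crossed module homomorphism from $\mathcal K$ to $(A^\times\xrightarrow{\partial}\mathrm{Aut}(A))$, $\partial(x)(y)=xyx^{-1}$) is a triple $(\omega_1,\omega_2,\omega_3)$: $\omega_1:G\to\mathrm{Aut}(A)$ is a group homomorphism (write ${}^{\mathbf f}a=\omega_1(\mathbf f)(a)$); $\omega_3:G\times G\to Z(A)^\times$ is a normalised cocycle: $\omega_3(\mathbf g,1)=\omega_3(1,\mathbf g)=1$ and ${}^{\mathbf f}\omega_3(\mathbf g,\mathbf h)\,\omega_3(\mathbf f,\mathbf g\mathbf h)=\omega_3(\mathbf f\mathbf g,\mathbf h)\,\omega_3(\mathbf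 f,\mathbf g)$; $\omega_2:H\to A^\times$ satisfies $\omega_2(xy)=\omega_3(\partial x,\partial y)\omega_2(x)\omega_2(y)$; and $$\omega_1(\partial x)=\partial(\omega_2(x)),\qquad \omega_2({}^{\mathbf f}x)={}^{\mathbf f}\omega_3(\partial x,\mathbf f^{-1})\;\omega_3(\mathbf f,\partial x\,\mathbf f^{-1})\;\omega_3(\mathbf f,\mathbf f^{-1})^{-1}\;{}^{\mathbf f}\omega_2(x).$$ It is a $\mathcal K$-algebra if $\omega_3\equiv1$. For $\mathbf g\in\mathrm{Aut}(A)$, $[\mathbf g]:A\text{-Mod}\to A\text{-Mod}$ sends $M$ to $M^{[\mathbf g]}$ ($M$ with action $a\cdot^{[\mathbf g]}m=\mathbf g(a)m$) and is the identity on underlying maps. For $\mathbf f,\mathbf g\in\mathrm{Aut}(A)$ and $x\in A$ with $xa=\mathbf g(\mathbf f^{-1}(a))x$ for all $a\in A$, $\Upsilon(x):[\mathbf f]\Rightarrow[\mathbf g]$ is the natural transformation $\Upsilon(x)_M:m\mapsto xm$. $2\text{-}\mathcal Aut(A\text{-Mod})$ is the 2-group with one object (identified with $A\text{-Mod}$), 1-morphisms the strong $\mathcal A^1$-module autoequivalences of $A\text{-Mod}$, where $\mathcal A^1$ is the monoidal category of finite-dimensional $\mathbb K$-vector spaces acting by $M\boxtimes X=M\otimes_{\mathbb K}X$ (a strong module functor is a functor $F$ with coherent natural isomorphisms $F(M\boxtimes X)\cong F(M)\boxtimes X$; for $[\mathbf g]$ these are identities), 2-morphisms the module natural isomorphisms,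 and $F_1\diamond F_2=F_2\circ F_1$. A 2-module here is a 2-functor (pseudofunctor); it is unital if its unit constraint is the identity, and strict if both unit and composition constraints are identities. *)

(* Defs.v *)
From HB Require Import structures.
From mathcomp Require Import all_boot all_order all_algebra.
From mathcomp Require Import boolp.

Set Implicit Arguments.
Unset Strict Implicit.
Unset Printing Implicit Defensive.

Import GRing.Theory VectorInternalTheory.
Local Open Scope ring_scope.

(** * Strict 2-categories and pseudofunctors *)

(* Composition of 1-morphisms [f ⋄ g] is written in diagrammatic order.
   Since [⋄] is associative and unital only up to propositional equality, the
   corresponding laws for 2-morphisms are stated up to the cells [eq2cell e],
   i.e. identity 2-morphisms transported along an equality of 1-morphisms. *)
Record twoCat := TwoCat {
  ob : Type;
  hom1 : ob -> ob -> Type;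
  hom2 : forall x y, hom1 x y -> hom1 x y -> Type;
  id1 : forall x, hom1 x x;
  comp1 : forall x y z, hom1 x y -> hom1 y z -> hom1 x z;
  id2 : forall x y (f : hom1 x y), hom2 f f;
  vcomp : forall x y (f g h : hom1 x y), hom2 g h -> hom2 f g -> hom2 f h;
  hcomp : forall x y z (f f' : hom1 x y) (g g' : hom1 y z),
    hom2 f f' -> hom2 g g' -> hom2 (comp1 f g) (comp1 f' g');
  eq2cell : forall x y (f g : hom1 x y), f = g -> hom2 f g :=
    fun x y f g e => match e in _ = g' return hom2 f g' with
                     | erefl => id2 f end;
  comp1A : forall x y z w (f : hom1 x y) (g : hom1 y z) (h : hom1 z w),
    comp1 (comp1 f g) h = comp1 f (comp1 g h);
  comp1l : forall x y (f : hom1 x y), comp1 (id1 x) f = f;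
  comp1r : forall x y (f : hom1 x y), comp1 f (id1 y) = f;
  vcompA : forall x y (f g h k : hom1 x y)
    (c : hom2 h k) (b : hom2 g h) (a : hom2 f g),
    vcomp (vcomp c b) a = vcomp c (vcomp b a);
  vcompl : forall x y (f g : hom1 x y) (a : hom2 f g), vcomp (id2 g) a = a;
  vcompr : forall x y (f g : hom1 x y) (a : hom2 f g), vcomp a (id2 f) = a;
  hcomp_id : forall x y z (f : hom1 x y) (g : hom1 y z),
    hcomp (id2 f) (id2 g) = id2 (comp1 f g);
  interchange : forall x y z (f f' f'' : hom1 x y) (g g' g'' : hom1 y z)
    (a' : hom2 f' f'') (a : hom2 f f') (b' : hom2 g' g'') (b : hom2 g g'),
    hcomp (vcomp a' a) (vcomp b' b) = vcomp (hcomp a' b') (hcomp a b);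
  hcompA : forall x y z w (f f' : hom1 x y) (g g' : hom1 y z) (h h' : hom1 z w)
    (a : hom2 f f') (b : hom2 g g') (c : hom2 h h'),
    vcomp (eq2cell (comp1A f' g' h')) (hcomp (hcomp a b) c) =
    vcomp (hcomp a (hcomp b c)) (eq2cell (comp1A f g h));
  hcompl : forall x y (f f' : hom1 x y) (a : hom2 f f'),
    vcomp (eq2cell (comp1l f')) (hcomp (id2 (id1 x)) a) =
    vcomp a (eq2cell (comp1l f));
  hcompr : forall x y (f f' : hom1 x y) (a : hom2 f f'),
    vcomp (eq2cell (comp1r f')) (hcomp a (id2 (id1 y))) =
    vcomp a (eq2cell (comp1r f))
}.

Arguments id1 {t} x.
Arguments comp1 {t x y z} f g.
Arguments id2 {t x y} f.
Arguments vcomp {t x y f g h} b a.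
Arguments hcomp {t x y z f f' g g'} a b.
Arguments eq2cell {t x y f g} e.
Arguments hom1 {t} x y.
Arguments hom2 {t x y} f g.
Arguments comp1A {t x y z w} f g h.
Arguments comp1l {t x y} f.
Arguments comp1r {t x y} f.

Declare Scope twocat_scope.
Delimit Scope twocat_scope with C2.
Notation "f ⋄ g" := (comp1 f g) (at level 40, left associativity) : twocat_scope.
Notation "a ⋄₂ b" := (hcomp a b) (at level 40, left associativity) : twocat_scope.
Notation "b • a" := (vcomp b a) (at level 45, left associativity) : twocat_scope.

Definition is_iso2 (C : twoCat) (x y : ob C) (f g : hom1 x y) (a : hom2 f g) :
    Prop :=
  exists b : hom2 g f, vcomp b a = id2 f /\ vcomp a b = id2 g.

(* Only meaningful when the two 1-morphisms are equal. *)
Definition is_id2 (C : twoCat) (x y : ob C) (f g : hom1 x y) (a : hom2 f g) :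
    Prop :=
  exists e : f = g, a = eq2cell e.

Record pfData (C D : twoCat) := PfData {
  pf0 : ob C -> ob D;
  pf1 : forall x y, hom1 x y -> hom1 (pf0 x) (pf0 y);
  pf2 : forall x y (f g : @hom1 C x y), hom2 f g -> hom2 (pf1 f) (pf1 g);
  pf_unit : forall x, hom2 (id1 (pf0 x)) (pf1 (id1 x));
  pf_comp : forall x y z (f : hom1 x y) (g : hom1 y z),
    hom2 (comp1 (pf1 f) (pf1 g)) (pf1 (comp1 f g))
}.

Arguments pf1 {C D} p {x y} f.
Arguments pf2 {C D} p {x y f g} a.
Arguments pf_unit {C D} p x.
Arguments pf_comp {C D} p {x y z} f g.

Local Open Scope twocat_scope.

Record is_pseudofunctor (C D : twoCat) (F : pfData C D) : Prop := {
  pf2_id : forall (x y : ob C) (f : hom1 x y), pf2 F (id2 f) = id2 (pf1 F f);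
  pf2_vcomp : forall (x y : ob C) (f g h : hom1 x y)
    (b : hom2 g h) (a : hom2 f g), pf2 F (b • a) = pf2 F b • pf2 F a;
  pf_unit_iso : forall x : ob C, is_iso2 (pf_unit F x);
  pf_comp_iso : forall (x y z : ob C) (f : hom1 x y) (g : hom1 y z),
    is_iso2 (pf_comp F f g);
  pf_comp_nat : forall (x y z : ob C) (f f' : hom1 x y) (g g' : hom1 y z)
    (a : hom2 f f') (b : hom2 g g'),
    pf_comp F f' g' • (pf2 F a ⋄₂ pf2 F b) = pf2 F (a ⋄₂ b) • pf_comp F f g;
  pf_comp_assoc : forall (x y z w : ob C)
    (f : hom1 x y) (g : hom1 y z) (h : hom1 z w),
    pf2 F (eq2cell (comp1A f g h)) • pf_comp F (f ⋄ g) h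
      • (pf_comp F f g ⋄₂ id2 (pf1 F h)) =
    pf_comp F f (g ⋄ h) • (id2 (pf1 F f) ⋄₂ pf_comp F g h)
      • eq2cell (comp1A (pf1 F f) (pf1 F g) (pf1 F h));
  pf_comp_unitl : forall (x y : ob C) (f : hom1 x y),
    pf2 F (eq2cell (comp1l f)) • pf_comp F (id1 x) f
      • (pf_unit F x ⋄₂ id2 (pf1 F f)) = eq2cell (comp1l (pf1 F f));
  pf_comp_unitr : forall (x y : ob C) (f : hom1 x y),
    pf2 F (eq2cell (comp1r f)) • pf_comp F f (id1 y)
      • (id2 (pf1 F f) ⋄₂ pf_unit F y) = eq2cell (comp1r (pf1 F f))
}.

Definition is_unital (C D : twoCat) (F : pfData C D) : Prop :=
  forall x : ob C, is_id2 (pf_unit F x).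

Definition is_strict (C D : twoCat) (F : pfData C D) : Prop :=
  is_unital F /\
  forall (x y z : ob C) (f : hom1 x y) (g : hom1 y z), is_id2 (pf_comp F f g).

Local Close Scope twocat_scope.

(** * Crossed modules and their 2-groups *)

Record crossedModule (H G : groupType) := CrossedModule {
  cm_d :> {multiplicative H -> G};
  cm_act : G -> H -> H;
  cm_act1 : forall h, cm_act 1%g h = h;
  cm_actM : forall f g h, cm_act (f * g)%g h = cm_act f (cm_act g h);
  cm_act_mul : forall g, {morph cm_act g : h k / (h * k)%g};
  cm_d_act : forall g h, cm_d (cm_act g h) = (g * cm_d h * g^-1)%g;
  cm_peiffer : forall h k, cm_act (cm_d h) k = (h * k * h^-1)%g
}.

Section TwoGroup.
Variables (H G : groupType) (X : crossedModule H G).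

(* A 2-morphism [f ⇒ g] is an [h] in [H] with [g = ∂(h) f]. *)
Record tgHom (f g : G) := TgHom {
  tg_val : H;
  tg_valP : g = (X tg_val * f)%g
}.

Lemma tgHom_eq f g (a b : tgHom f g) : tg_val a = tg_val b -> a = b.
Proof.
case: a b => [a pa] [b pb] /= e; case: b / e pb => pb.
by rewrite (Prop_irrelevance pa pb).
Qed.

Lemma cm_d1 : X 1%g = 1%g.
Proof. by apply: (mulgI (X 1%g)); rewrite -gmulfM !mulg1. Qed.

Lemma cm_act_1 g : cm_act X g 1%g = 1%g.
Proof. by apply: (mulgI (cm_act X g 1%g)); rewrite -cm_act_mul !mulg1. Qed.

Fact tg_id_subproof (f : G) : f = (X 1%g * f)%g.
Proof. by rewrite cm_d1 mul1g. Qed.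
Definition tg_id f : tgHom f f := TgHom (tg_id_subproof f).

Fact tg_vcomp_subproof (f g h : G) (b : tgHom g h) (a : tgHom f g) :
  h = (X (tg_val b * tg_val a) * f)%g.
Proof. by rewrite gmulfM -mulgA -tg_valP -tg_valP. Qed.
Definition tg_vcomp f g h (b : tgHom g h) (a : tgHom f g) : tgHom f h :=
  TgHom (tg_vcomp_subproof b a).

Fact tg_hcomp_subproof (f f' g g' : G) (a : tgHom f f') (b : tgHom g g') :
  (f' * g' = X (tg_val a * cm_act X f (tg_val b)) * (f * g))%g.
Proof.
rewrite [LHS](congr2 _ (tg_valP a) (tg_valP b)) gmulfM cm_d_act.
by rewrite !mulgA mulgVK.
Qed.
Definition tg_hcomp f f' g g' (a : tgHom f f') (b : tgHom g g') :
  tgHom (f * g)%g (f' * g')%g := TgHom (tg_hcomp_subproof a b).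

Lemma tg_eq2cell f g (e : f = g) :
  tg_val (match e in _ = g' return tgHom f g' with erefl => tg_id f end) = 1%g.
Proof. by case: g / e. Qed.

Lemma cm_peiffer_comm (h k : H) :
  (cm_act X (X h) k * h = h * k)%g.
Proof. by rewrite cm_peiffer mulgVK. Qed.

Definition twoGroup : twoCat.
Proof.
refine (@TwoCat unit (fun _ _ => G) (fun _ _ => tgHom) (fun _ => 1%g)
  (fun _ _ _ f g => f * g)%g (fun _ _ => tg_id) (fun _ _ => tg_vcomp)
  (fun _ _ _ => tg_hcomp) (fun _ _ _ _ f g h => esym (mulgA f g h))
  (fun _ _ => @mul1g _) (fun _ _ => @mulg1 _) _ _ _ _ _ _ _ _).
- by move=> *; apply: tgHom_eq; rewrite /= mulgA.
- by move=> *; apply: tgHom_eq; rewrite /= mul1g.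
- by move=> *; apply: tgHom_eq; rewrite /= mulg1.
- by move=> *; apply: tgHom_eq; rewrite /= cm_act_1 mulg1.
- move=> _ _ _ f f' f'' g g' g'' a' a b' b; apply: tgHom_eq => /=.
  have -> h : cm_act X f' h = cm_act X (X (tg_val a) * f)%g h by rewrite -tg_valP.
  rewrite cm_act_mul cm_actM -!mulgA; congr (_ * _)%g.
  by rewrite !mulgA cm_peiffer_comm.
- move=> _ _ _ _ f f' g g' h h' a b c; apply: tgHom_eq => /=.
  by rewrite !tg_eq2cell mul1g mulg1 cm_act_mul cm_actM mulgA.
- move=> _ _ f f' a; apply: tgHom_eq => /=.
  by rewrite !tg_eq2cell mulg1 !mul1g cm_act1.
- move=> _ _ f f' a; apply: tgHom_eq => /=.
  by rewrite !tg_eq2cell mul1g cm_act_1.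
Defined.

End TwoGroup.

(** * Algebras, modules, and the action of finite-dimensional vector spaces *)

(* Unital associative K-algebras, as rings with a central morphism from K
   ([algType K] would exclude the zero algebra). *)
Record kAlgebra (K : fieldType) := KAlgebra {
  ka_ring :> pzRingType;
  ka_emb : {rmorphism K -> ka_ring};
  ka_central : forall k a, ka_emb k * a = a * ka_emb k
}.

Record kAut (K : fieldType) (A : kAlgebra K) := KAut {
  kaut_map :> {rmorphism A -> A};
  kaut_inv : A -> A;
  kaut_mapK : cancel kaut_map kaut_inv;
  kaut_invK : cancel kaut_inv kaut_map;
  kaut_emb : forall k, kaut_map (ka_emb A k) = ka_emb A k
}.

Record unitOf (R : pzSemiRingType) := UnitOf {
  u_val :> R;
  u_inv : R;
  u_valV : u_val * u_inv = 1;
  u_Vval : u_inv * u_val = 1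
}.

Fact u_mul_valV (R : pzSemiRingType) (x y : unitOf R) :
  x * y * (u_inv y * u_inv x) = 1.
Proof. by rewrite mulrA -(mulrA _ _ (u_inv y)) u_valV mulr1 u_valV. Qed.
Fact u_mul_Vval (R : pzSemiRingType) (x y : unitOf R) :
  u_inv y * u_inv x * (x * y) = 1.
Proof. by rewrite mulrA -(mulrA _ (u_inv x)) u_Vval mulr1 u_Vval. Qed.
Definition u_mul (R : pzSemiRingType) (x y : unitOf R) : unitOf R :=
  UnitOf (u_mul_valV x y) (u_mul_Vval x y).

Lemma lin_ext (R : pzRingType) (M N : lmodType R) (f g : {linear M -> N}) :
  f =1 g -> f = g.
Proof.
case: f g => [f [[pf] [qf]]] [g [[pg] [qg]]] /= fg.
have e : f = g by apply: funext.
case: g / e {fg} pg qg => pg qg.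
by rewrite (Prop_irrelevance pf pg) (Prop_irrelevance qf qg).
Qed.

Section Tensor.
Variables (K : fieldType) (A : kAlgebra K).
Implicit Types (M N P : lmodType A) (X Y Z : vectType K).

(* A model of [M ⊗_K X], for an [A]-module [M] and a finite-dimensional [X]:
   the tuples of coefficients, in [M], on the basis [r2v (delta_mx 0 i)] of [X].
   Its universal property is [tensP] below. *)
Definition tens M X : lmodType A := {ffun 'I_(dim X) -> M}.

Definition ptens M X (x : X) (m : M) : tens M X :=
  [ffun i => ka_emb A (v2r x 0 i) *: m].

Fact ptens_linear M X (x : X) : linear (@ptens M X x).
Proof.
move=> a m n; apply/ffunP => i; rewrite !ffunE scalerDr !scalerA.
by rewrite ka_central.
Qed.
HB.instance Definition _ M X (x : X) :=
  GRing.isLinear.Build A M (tens M X) _ (@ptens M X x) (@ptens_linear M X x).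

Lemma ptens_linearr M X (m : M) (k : K) (x y : X) :
  ptens (k *: x + y) m = ka_emb A k *: ptens x m + ptens y m.
Proof.
by apply/ffunP => i; rewrite !ffunE linearP !mxE rmorphD rmorphM scalerDl scalerA.
Qed.

Definition tbasis X (i : 'I_(dim X)) : X := r2v (delta_mx 0 i).

Definition tlift M X N (b : X -> {linear M -> N}) (t : tens M X) : N :=
  \sum_(i < dim X) b (tbasis i) (t i).

Fact tlift_linear M X N (b : X -> {linear M -> N}) : linear (tlift b).
Proof.
move=> a s t; rewrite /tlift scaler_sumr -big_split /=; apply: eq_bigr => i _.
by rewrite !ffunE linearP.
Qed.
HB.instance Definition _ M X N (b : X -> {linear M -> N}) :=
  GRing.isLinear.Build A (tens M X) N _ (tlift b) (tlift_linear b).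

Definition balanced M X N (b : X -> {linear M -> N}) : Prop :=
  forall m k x y, b (k *: x + y) m = ka_emb A k *: b x m + b y m.

Lemma balanced_sum M X N (b : X -> {linear M -> N}) m I (r : seq I)
    (c : I -> K) (x : I -> X) : balanced b ->
  b (\sum_(i <- r) c i *: x i) m = \sum_(i <- r) ka_emb A (c i) *: b (x i) m.
Proof.
move=> bb; elim: r => [|i r IH]; last by rewrite !big_cons bb IH.
rewrite !big_nil; apply: (addrI (b 0 m)).
by have := bb m 1 0 0; rewrite scaler0 addr0 rmorph1 scale1r => <-; rewrite addr0.
Qed.

Lemma tbasis_sum X (x : X) : x = \sum_(i < dim X) v2r x 0 i *: tbasis i.
Proof.
apply: v2r_inj; rewrite linear_sum [LHS]row_sum_delta; apply: eq_bigr => i _.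
by rewrite linearZ /= r2vK.
Qed.

Lemma tlift_ptens M X N (b : X -> {linear M -> N}) : balanced b ->
  forall x m, tlift b (ptens x m) = b x m.
Proof.
move=> bb x m; rewrite [in RHS](tbasis_sum x) balanced_sum //.
by apply: eq_bigr => i _; rewrite ffunE linearZ.
Qed.

Lemma tens_sum M X (t : tens M X) :
  t = \sum_(i < dim X) ptens (tbasis i) (t i).
Proof.
apply/ffunP => j; rewrite sum_ffunE (bigD1 j) //= ffunE r2vK mxE !eqxx rmorph1.
rewrite scale1r big1 ?addr0 // => i ij.
by rewrite ffunE r2vK mxE eq_sym (negbTE ij) andbF rmorph0 scale0r.
Qed.

Lemma tens_ext M X N (f g : {linear tens M X -> N}) :
  (forall x m, f (ptens x m) = g (ptens x m)) -> f =1 g.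
Proof.
move=> fg t; rewrite (tens_sum t) !linear_sum.
by apply: eq_bigr => i _; apply: fg.
Qed.

(* [A]-linear maps out of [tens M X] are the same as the maps [M × X -> N]
   that are [A]-linear in [M] and [K]-linear in [X]. *)
Lemma tensP M X N (b : X -> {linear M -> N}) : balanced b ->
  exists! f : {linear tens M X -> N}, forall x m, f (ptens x m) = b x m.
Proof.
move=> bb; exists (tlift b); split; first exact: tlift_ptens.
move=> f fb; apply/lin_ext/tens_ext => x m.
by rewrite fb /= tlift_ptens.
Qed.

(* The functor [⊠] on morphisms: [m ⊗ x] is sent to [f m ⊗ g x]. *)
Definition tmap M N X Y (f : {linear M -> N}) (g : {linear X -> Y}) :
    tens M X -> tens N Y :=
  tlift (fun x => @ptens N Y (g x) \o f).
HB.instance Definition _ M N X Y (f : {linear M -> N}) (g : {linear X -> Y}) :=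
  GRing.Linear.copy (tmap f g) (tlift (fun x => @ptens N Y (g x) \o f)).

Lemma tmap_ptens M N X Y (f : {linear M -> N}) (g : {linear X -> Y}) x m :
  tmap f g (ptens x m) = ptens (g x) (f m).
Proof.
rewrite /tmap /= tlift_ptens // => n k y z /=.
by rewrite linearP ptens_linearr.
Qed.

(* Tensor product of vector spaces, by the same formula. *)
Definition vtens X Y : vectType K := {ffun 'I_(dim Y) -> X}.

Definition pvtens X Y (x : X) (y : Y) : vtens X Y := [ffun i => v2r y 0 i *: x].

Lemma pvtens_linearl X Y (y : Y) k (x x' : X) :
  pvtens (k *: x + x') y = k *: pvtens x y + pvtens x' y.
Proof.
by apply/ffunP => i; rewrite !ffunE scalerDr !scalerA mulrC.
Qed.

Lemma pvtens_linearr X Y (x : X) k (y y' : Y) :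
  pvtens x (k *: y + y') = k *: pvtens x y + pvtens x y'.
Proof.
by apply/ffunP => i; rewrite !ffunE linearP !mxE scalerDl scalerA.
Qed.

(* The associativity isomorphism, [(m ⊗ x) ⊗ y] to [m ⊗ (x ⊗ y)]. *)
Definition tassoc M X Y : tens (tens M X) Y -> tens M (vtens X Y) :=
  tlift (fun y => tlift (fun x => @ptens M (vtens X Y) (pvtens x y))).
HB.instance Definition _ M X Y :=
  GRing.Linear.copy (@tassoc M X Y)
    (tlift (fun y => tlift (fun x => @ptens M (vtens X Y) (pvtens x y)))).

Lemma tassoc_ptens M X Y (m : M) (x : X) (y : Y) :
  tassoc (ptens y (ptens x m)) = ptens (pvtens x y) m.
Proof.
have bx z : balanced (fun x => @ptens M (vtens X Y) (pvtens x z)).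
  by move=> n k u v /=; rewrite pvtens_linearl ptens_linearr.
rewrite /tassoc /= tlift_ptens; first exact: (tlift_ptens (bx y)).
move=> t k u v /=; rewrite /tlift scaler_sumr -big_split /=; apply: eq_bigr => i _.
by rewrite pvtens_linearr ptens_linearr.
Qed.

Definition kscale M (k : K) (m : M) : M := ka_emb A k *: m.
Fact kscale_linear M k : linear (@kscale M k).
Proof. by move=> a m n; rewrite /kscale scalerDr !scalerA ka_central. Qed.
HB.instance Definition _ M k :=
  GRing.isLinear.Build A M M _ (@kscale M k) (@kscale_linear M k).

(* The unit isomorphism, [m ⊗ k] to [k m]. *)
Definition tunit M : tens M K^o -> M := tlift (fun k : K^o => @kscale M k).
HB.instance Definition _ M :=
  GRing.Linear.copy (@tunit M) (tlift (fun k : K^o => @kscale M k)).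

Lemma tunit_ptens M (m : M) (k : K^o) : tunit (ptens k m) = ka_emb A k *: m.
Proof.
rewrite /tunit /= tlift_ptens //= => n c x y /=.
by rewrite /kscale rmorphD rmorphM scalerDl scalerA.
Qed.

End Tensor.


(** * The 2-group of module autoequivalences of A-Mod *)

Section ModuleFunctors.
Variables (K : fieldType) (A : kAlgebra K).
Implicit Types (M N P : lmodType A) (X Y Z : vectType K).

(* Strong module endofunctors of A-Mod; [mf_str] is the structural isomorphism
   [F (M ⊠ X) ≅ F M ⊠ X]. *)
Record modFunctor := ModFunctor {
  mf_ob :> lmodType A -> lmodType A;
  mf_map : forall M N, {linear M -> N} -> {linear mf_ob M -> mf_ob N};
  mf_str : forall M X, {linear mf_ob (tens M X) -> tens (mf_ob M) X};
  mf_map_id : forall M (m : mf_ob M), mf_map (idfun : {linear M -> M}) m = m;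
  mf_map_comp : forall M N P (g : {linear N -> P}) (f : {linear M -> N}) m,
    mf_map (g \o f : {linear M -> P}) m = mf_map g (mf_map f m);
  mf_str_bij : forall M X, bijective (mf_str M X);
  mf_str_nat : forall M N X Y (f : {linear M -> N}) (g : {linear X -> Y}) m,
    mf_str N Y (mf_map (tmap f g) m) = tmap (mf_map f) g (mf_str M X m);
  mf_str_assoc : forall M X Y m,
    mf_str M (vtens X Y) (mf_map (@tassoc K A M X Y) m) =
    tassoc
      (tmap (mf_str M X) (idfun : {linear Y -> Y}) (mf_str (tens M X) Y m));
  mf_str_unit : forall M m,
    tunit (mf_str M K^o m) = mf_map (@tunit K A M) m
}.

Record modIso (F G : modFunctor) := ModIso {
  mi_map :> forall M, {linear F M -> G M};
  mi_bij : forall M, bijective (mi_map M);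
  mi_nat : forall M N (f : {linear M -> N}) m,
    mi_map N (mf_map F f m) = mf_map G f (mi_map M m);
  mi_str : forall M X m,
    tmap (mi_map M) (idfun : {linear X -> X}) (mf_str F M X m) =
    mf_str G M X (mi_map (tens M X) m)
}.

Lemma modIso_eq F G (a b : modIso F G) : (forall M, a M =1 b M) -> a = b.
Proof.
case: a b => [a pa qa ra] [b pb qb rb] /= ab.
have e : a = b by apply: functional_extensionality_dep => M; apply: lin_ext; exact: ab.
case: b / e {ab} pb qb rb => pb qb rb.
by rewrite (Prop_irrelevance pa pb) (Prop_irrelevance qa qb)
  (Prop_irrelevance ra rb).
Qed.

Lemma modFunctor_eq (o : lmodType A -> lmodType A) m
    (s s' : forall M X, {linear o (tens M X) -> tens (o M) X}) p1 p2 p3 p4 p5 p6 q1 q2 q3 q4 q5 q6 :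
  (forall M X, s M X =1 s' M X) ->
  @ModFunctor o m s p1 p2 p3 p4 p5 p6 = @ModFunctor o m s' q1 q2 q3 q4 q5 q6.
Proof.
move=> ss'.
have e : s = s'.
  apply: functional_extensionality_dep => M.
  by apply: functional_extensionality_dep => X; apply: lin_ext; exact: ss'.
case: s' / e {ss'} q3 q4 q5 q6 => q3 q4 q5 q6.
by rewrite (Prop_irrelevance p1 q1) (Prop_irrelevance p2 q2)
  (Prop_irrelevance p3 q3) (Prop_irrelevance p4 q4) (Prop_irrelevance p5 q5)
  (Prop_irrelevance p6 q6).
Qed.

Lemma tmap_id M X (f : {linear M -> M}) (g : {linear X -> X}) :
  f =1 idfun -> g =1 idfun -> tmap f g =1 idfun.
Proof.
move=> f1 g1; apply: (@tens_ext _ _ _ _ _ _ idfun) => x m.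
by rewrite /= tmap_ptens f1 g1.
Qed.

Lemma tmap_comp M N P X Y Z (f : {linear M -> N}) (f' : {linear N -> P})
    (g : {linear X -> Y}) (g' : {linear Y -> Z}) t :
  tmap f' g' (tmap f g t) = tmap (f' \o f) (g' \o g) t.
Proof.
move: t; apply: (@tens_ext _ _ _ _ _ (tmap f' g' \o tmap f g)) => x m.
by rewrite /= !tmap_ptens.
Qed.

Lemma tmap_eq M N X Y (f f' : {linear M -> N}) (g g' : {linear X -> Y}) :
  f =1 f' -> g =1 g' -> tmap f g =1 tmap f' g'.
Proof. by move=> /lin_ext -> /lin_ext ->. Qed.

Lemma tassoc_nat M N X Y (f : {linear M -> N}) t :
  tassoc (tmap (tmap f (idfun : {linear X -> X})) idfun t) =
  tmap f (idfun : {linear vtens X Y -> vtens X Y}) (tassoc t).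
Proof.
move: t; apply: (@tens_ext _ _ _ _ _
  (@tassoc K A N X Y \o tmap (tmap f (idfun : {linear X -> X})) idfun)
  (tmap f idfun \o @tassoc K A M X Y)) => y t /=.
rewrite tmap_ptens /=.
move: t; apply: (@tens_ext _ _ _ _ _
  (@tassoc K A N X Y \o @ptens _ _ _ _ y \o tmap f (idfun : {linear X -> X}))
  (tmap f idfun \o @tassoc K A M X Y \o @ptens _ _ _ _ y)) => x m /=.
by rewrite tmap_ptens !tassoc_ptens tmap_ptens.
Qed.

Lemma mf_map_eq (F : modFunctor) M N (f g : {linear M -> N}) :
  f =1 g -> mf_map F f =1 mf_map F g.
Proof. by move=> /lin_ext ->. Qed.

Lemma mf_map_inv (F : modFunctor) M N (f : {linear M -> N})
    (g : {linear N -> M}) : cancel f g -> cancel (mf_map F f) (mf_map F g).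
Proof.
move=> fK m; rewrite -mf_map_comp -[RHS]mf_map_id.
exact: mf_map_eq.
Qed.

Lemma bij_lin_inv M N (f : {linear M -> N}) : bijective f ->
  exists2 g : {linear N -> M}, cancel f g & cancel g f.
Proof.
case=> g fg gf.
have lg : linear g by move=> a x y; apply: (can_inj fg); rewrite linearP !gf.
pose L := GRing.isLinear.Build A N M _ g lg.
by exists (HB.pack g L : {linear N -> M}).
Qed.

Lemma mf_map_bij (F : modFunctor) M N (f : {linear M -> N}) :
  bijective f -> bijective (mf_map F f).
Proof.
move=> /bij_lin_inv[g fg gf].
by exists (mf_map F g); apply: mf_map_inv.
Qed.

Fact mfi_assoc M X Y (m : tens (tens M X) Y) :
  idfun (tassoc m) =
  tassoc (tmap (idfun : {linear tens M X -> tens M X})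
            (idfun : {linear Y -> Y}) (idfun m)).
Proof. by congr (tassoc _); rewrite tmap_id. Qed.

Definition mf_id : modFunctor :=
  @ModFunctor (fun M => M) (fun _ _ f => f) (fun _ _ => idfun)
    (fun _ _ => erefl) (fun _ _ _ _ _ _ => erefl)
    (fun _ _ => Bijective (fun=> erefl) (fun=> erefl))
    (fun _ _ _ _ _ _ _ => erefl) mfi_assoc (fun _ _ => erefl).

Section Composition.
Variables F G : modFunctor.

Definition mfc_map M N (f : {linear M -> N}) : {linear G (F M) -> G (F N)} :=
  mf_map G (mf_map F f).

Definition mfc_str M X : {linear G (F (tens M X)) -> tens (G (F M)) X} :=
  mf_str G (F M) X \o mf_map G (mf_str F M X).

Fact mfc_map_id M (m : G (F M)) : mfc_map (idfun : {linear M -> M}) m = m.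
Proof.
rewrite /mfc_map -[RHS]mf_map_id.
by apply: mf_map_eq => n; rewrite mf_map_id.
Qed.

Fact mfc_map_comp M N P (g : {linear N -> P}) (f : {linear M -> N}) m :
  mfc_map (g \o f : {linear M -> P}) m = mfc_map g (mfc_map f m).
Proof.
rewrite /mfc_map -mf_map_comp.
by apply: mf_map_eq => n; rewrite mf_map_comp.
Qed.

Fact mfc_str_bij M X : bijective (mfc_str M X).
Proof.
apply: bij_comp; first exact: mf_str_bij.
exact/mf_map_bij/mf_str_bij.
Qed.

Fact mfc_str_nat M N X Y (f : {linear M -> N}) (g : {linear X -> Y}) m :
  mfc_str N Y (mfc_map (tmap f g) m) = tmap (mfc_map f) g (mfc_str M X m).
Proof.
rewrite /= -mf_str_nat -!mf_map_comp; congr (mf_str _ _ _ _).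
by apply: mf_map_eq => n /=; rewrite mf_str_nat.
Qed.

Fact mfc_str_assoc M X Y m :
  mfc_str M (vtens X Y) (mfc_map (@tassoc K A M X Y) m) =
  tassoc (tmap (mfc_str M X) (idfun : {linear Y -> Y})
            (mfc_str (tens M X) Y m)).
Proof.
rewrite /= -!mf_map_comp.
rewrite (mf_map_eq (g := @tassoc _ _ _ _ _ \o (tmap (mf_str F M X) idfun
   \o mf_str F (tens M X) Y))); last by move=> n /=; rewrite mf_str_assoc.
rewrite mf_map_comp mf_str_assoc; congr (tassoc _).
by rewrite mf_map_comp mf_str_nat tmap_comp; apply: tmap_eq.
Qed.

Fact mfc_str_unit M m :
  tunit (mfc_str M K^o m) = mfc_map (@tunit K A M) m.
Proof.
rewrite /= mf_str_unit -mf_map_comp.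
by apply: mf_map_eq => n /=; rewrite mf_str_unit.
Qed.

(* This is [F ⋄ G = G ∘ F]. *)
Definition mf_comp : modFunctor :=
  @ModFunctor (fun M => G (F M)) mfc_map mfc_str mfc_map_id mfc_map_comp
    mfc_str_bij mfc_str_nat mfc_str_assoc mfc_str_unit.

End Composition.

Fact mi_id_str (F : modFunctor) M X m :
  tmap (idfun : {linear F M -> F M}) (idfun : {linear X -> X})
    (mf_str F M X m) = mf_str F M X m.
Proof. by rewrite tmap_id. Qed.

Definition mi_id (F : modFunctor) : modIso F F :=
  @ModIso F F (fun M => (idfun : {linear F M -> F M}))
    (fun M => Bijective (fun=> erefl) (fun=> erefl)) (fun _ _ _ _ => erefl) (@mi_id_str F).

Section VComp.
Variables (F G H : modFunctor) (b : modIso G H) (a : modIso F G).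

Definition mi_vmap M : {linear F M -> H M} := b M \o a M.

Fact mi_vmap_bij M : bijective (mi_vmap M).
Proof. by apply: bij_comp; apply: mi_bij. Qed.

Fact mi_vmap_nat M N (f : {linear M -> N}) m :
  mi_vmap N (mf_map F f m) = mf_map H f (mi_vmap M m).
Proof. by rewrite /= !mi_nat. Qed.

Fact mi_vmap_str M X m :
  tmap (mi_vmap M) (idfun : {linear X -> X}) (mf_str F M X m) =
  mf_str H M X (mi_vmap (tens M X) m).
Proof. by rewrite /= -mi_str -mi_str tmap_comp; apply: tmap_eq. Qed.

Definition mi_vcomp : modIso F H := ModIso mi_vmap_bij mi_vmap_nat mi_vmap_str.

End VComp.

Section HComp.
Variables (F F' G G' : modFunctor) (a : modIso F F') (b : modIso G G').

Definition mi_hmap M : {linear mf_comp F G M -> mf_comp F' G' M} :=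
  b (F' M) \o mf_map G (a M).

Fact mi_hmap_bij M : bijective (mi_hmap M).
Proof. exact: (bij_comp (mi_bij b (F' M)) (mf_map_bij G (mi_bij a M))). Qed.

Fact mi_hmap_nat M N (f : {linear M -> N}) m :
  mi_hmap N (mf_map (mf_comp F G) f m) =
  mf_map (mf_comp F' G') f (mi_hmap M m).
Proof.
rewrite /= -mi_nat -!mf_map_comp; congr (b _ _).
by apply: mf_map_eq => n /=; rewrite mi_nat.
Qed.

Fact mi_hmap_str M X m :
  tmap (mi_hmap M) (idfun : {linear X -> X}) (mf_str (mf_comp F G) M X m) =
  mf_str (mf_comp F' G') M X (mi_hmap (tens M X) m).
Proof.
rewrite /= -mi_nat -mi_str -!mf_map_comp.
rewrite (mf_map_eq (g := tmap (a M) idfun \o mf_str F M X)); last first.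
  by move=> n /=; rewrite mi_str.
by rewrite mf_map_comp mf_str_nat tmap_comp; apply: tmap_eq.
Qed.

Definition mi_hcomp : modIso (mf_comp F G) (mf_comp F' G') :=
  ModIso mi_hmap_bij mi_hmap_nat mi_hmap_str.

End HComp.

Lemma mf_compA F G H :
  mf_comp (mf_comp F G) H = mf_comp F (mf_comp G H).
Proof.
by apply: modFunctor_eq => M X m; rewrite /= mf_map_comp.
Qed.

Lemma mf_comp1l F : mf_comp mf_id F = F.
Proof.
case: F => o m s p1 p2 p3 p4 p5 p6; apply: modFunctor_eq => M X t /=.
by rewrite p1.
Qed.

Lemma mf_comp1r F : mf_comp F mf_id = F.
Proof. by case: F => *; apply: modFunctor_eq. Qed.

(* Invertible 2-morphisms between module functors are the module isomorphisms,
   so this is equivalence in the 2-category of module endofunctors. *)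
Definition is_equivalence (F : modFunctor) : Prop :=
  exists G : modFunctor,
    inhabited (modIso (mf_comp F G) mf_id) /\
    inhabited (modIso (mf_comp G F) mf_id).

Lemma is_equivalence_id : is_equivalence mf_id.
Proof. by exists mf_id; split; rewrite mf_comp1l; split; apply: mi_id. Qed.

Lemma is_equivalence_comp F G :
  is_equivalence F -> is_equivalence G -> is_equivalence (mf_comp F G).
Proof.
move=> [F' [[a] [a']]] [G' [[b] [b']]]; exists (mf_comp G' F'); split; split.
  rewrite mf_compA -(mf_compA G); apply: mi_vcomp a _.
  rewrite -[X in modIso _ (mf_comp _ X)]mf_comp1l.
  exact: mi_hcomp (mi_id F) (mi_hcomp b (mi_id F')).
rewrite mf_compA -(mf_compA F'); apply: mi_vcomp b' _.
rewrite -[X in modIso _ (mf_comp _ X)]mf_comp1l.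
exact: mi_hcomp (mi_id G') (mi_hcomp a' (mi_id G)).
Qed.

Record autoEquiv := AutoEquiv {
  ae_fun :> modFunctor;
  ae_equiv : is_equivalence ae_fun
}.

Lemma autoEquiv_eq (F G : autoEquiv) : F = G :> modFunctor -> F = G.
Proof.
case: F G => [F p] [G q] /= e; case: G / e q => q.
by rewrite (Prop_irrelevance p q).
Qed.

Definition ae_id : autoEquiv := AutoEquiv is_equivalence_id.
Definition ae_comp (F G : autoEquiv) : autoEquiv :=
  AutoEquiv (is_equivalence_comp (ae_equiv F) (ae_equiv G)).

Lemma ae_compA F G H : ae_comp (ae_comp F G) H = ae_comp F (ae_comp G H).
Proof. exact/autoEquiv_eq/mf_compA. Qed.

Lemma ae_comp1l F : ae_comp ae_id F = F.
Proof. exact/autoEquiv_eq/mf_comp1l. Qed.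

Lemma ae_comp1r F : ae_comp F ae_id = F.
Proof. exact/autoEquiv_eq/mf_comp1r. Qed.

Definition lin_cast M N (e : M = N) : {linear M -> N} :=
  match e in _ = N' return {linear M -> N'} with erefl => idfun end.

Definition ae_eq2 (F G : autoEquiv) (e : F = G) : modIso F G :=
  match e in _ = G' return modIso F G' with erefl => mi_id F end.

Lemma ae_eq2E (F G : autoEquiv) (e : F = G) M (e' : F M = G M) :
  ae_eq2 e M =1 lin_cast e'.
Proof. by case: G / e e' => e'; rewrite (Prop_irrelevance e' erefl). Qed.

Lemma ae_eq2A F G H M m : ae_eq2 (ae_compA F G H) M m = m.
Proof. exact: (ae_eq2E (ae_compA F G H) (erefl (H (G (F M))))). Qed.

Lemma ae_eq2l F M m : ae_eq2 (ae_comp1l F) M m = m.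
Proof. exact: (ae_eq2E (ae_comp1l F) (erefl (F M))). Qed.

Lemma ae_eq2r F M m : ae_eq2 (ae_comp1r F) M m = m.
Proof. exact: (ae_eq2E (ae_comp1r F) (erefl (F M))). Qed.

Lemma mi_hcompA (F F' G G' H H' : autoEquiv)
    (a : modIso F F') (b : modIso G G') (c : modIso H H') :
  mi_vcomp (ae_eq2 (ae_compA F' G' H')) (mi_hcomp (mi_hcomp a b) c) =
  mi_vcomp (mi_hcomp a (mi_hcomp b c)) (ae_eq2 (ae_compA F G H)).
Proof.
apply: modIso_eq => M m.
transitivity (mi_hcomp (mi_hcomp a b) c M m); first exact: ae_eq2A.
transitivity (mi_hcomp a (mi_hcomp b c) M m); first by rewrite /= mf_map_comp.
exact/(congr1 (mi_hcomp a (mi_hcomp b c) M))/esym/ae_eq2A.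
Qed.

Lemma mi_hcompl (F F' : autoEquiv) (a : modIso F F') :
  mi_vcomp (ae_eq2 (ae_comp1l F')) (mi_hcomp (mi_id mf_id) a) =
  mi_vcomp a (ae_eq2 (ae_comp1l F)).
Proof.
apply: modIso_eq => M m.
transitivity (mi_hcomp (mi_id mf_id) a M m); first exact: ae_eq2l.
transitivity (a M m); first by rewrite /= mf_map_id.
exact/(congr1 (a M))/esym/ae_eq2l.
Qed.

Lemma mi_hcompr (F F' : autoEquiv) (a : modIso F F') :
  mi_vcomp (ae_eq2 (ae_comp1r F')) (mi_hcomp a (mi_id mf_id)) =
  mi_vcomp a (ae_eq2 (ae_comp1r F)).
Proof.
apply: modIso_eq => M m.
transitivity (a M m); first exact: ae_eq2r.
exact/(congr1 (a M))/esym/ae_eq2r.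
Qed.

Definition twoAut : twoCat.
Proof.
refine (@TwoCat unit (fun _ _ => autoEquiv) (fun _ _ => modIso) (fun _ => ae_id)
  (fun _ _ _ => ae_comp) (fun _ _ => mi_id) (fun _ _ => mi_vcomp)
  (fun _ _ _ => mi_hcomp) (fun _ _ _ _ => ae_compA) (fun _ _ => ae_comp1l)
  (fun _ _ => ae_comp1r) _ _ _ _ _ (fun _ _ _ _ => mi_hcompA)
  (fun _ _ => mi_hcompl) (fun _ _ => mi_hcompr)).
- by move=> *; apply: modIso_eq.
- by move=> *; apply: modIso_eq.
- by move=> *; apply: modIso_eq.
- by move=> *; apply: modIso_eq => M m /=; rewrite mf_map_id.
- move=> _ _ _ F F' F'' G G' G'' a' a b' b; apply: modIso_eq => M m /=.
  by rewrite mf_map_comp mi_nat.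
Defined.

End ModuleFunctors.

(** * The autoequivalences [g] and the transformations Υ(x) *)

Section Twist.
Variables (K : fieldType) (A : kAlgebra K).
Implicit Types (f g : kAut A) (M N : lmodType A) (X Y : vectType K).

Definition twist_sort g M : Type := M.

HB.instance Definition _ g M := GRing.Zmodule.copy (twist_sort g M) M.

Definition twist_scale g M (a : A) (m : twist_sort g M) : twist_sort g M :=
  g a *: (m : M).

Fact twist_scaleA g M a b (m : twist_sort g M) :
  twist_scale a (twist_scale b m) = twist_scale (a * b) m.
Proof. by rewrite /twist_scale scalerA rmorphM. Qed.
Fact twist_scale0 g M (m : twist_sort g M) : twist_scale 0 m = 0.
Proof. by rewrite /twist_scale rmorph0 scale0r. Qed.
Fact twist_scale1 g M : left_id 1 (@twist_scale g M).
Proof. by move=> m; rewrite /twist_scale rmorph1 scale1r. Qed.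
Fact twist_scaleDr g M a : {morph (@twist_scale g M a) : m n / m + n}.
Proof. by move=> m n; rewrite /twist_scale -scalerDr. Qed.
Fact twist_scaleDl g M (m : twist_sort g M) :
  {morph (@twist_scale g M)^~ m : a b / a + b}.
Proof. by move=> a b; rewrite /twist_scale rmorphD scalerDl. Qed.

HB.instance Definition _ g M :=
  GRing.Nmodule_isLSemiModule.Build A (twist_sort g M)
    (@twist_scaleA g M) (@twist_scale0 g M) (@twist_scale1 g M)
    (@twist_scaleDr g M) (@twist_scaleDl g M).

(* The twisted module [M^[g]]. *)
Definition twist g M : lmodType A := twist_sort g M.

Lemma twistE g M (a : A) (m : twist g M) : a *: m = g a *: (m : M) :> M.
Proof. by []. Qed.

Section TwistMap.
Variables (g : kAut A) (M N : lmodType A) (X : vectType K) (h : {linear M -> N}).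

Definition tw_map_fun : twist g M -> twist g N := h.
Fact tw_map_linear : linear tw_map_fun.
Proof. by move=> a m n; rewrite /tw_map_fun !twistE linearP. Qed.
HB.instance Definition _ :=
  GRing.isLinear.Build A (twist g M) (twist g N) _ tw_map_fun tw_map_linear.
Definition tw_map : {linear twist g M -> twist g N} := tw_map_fun.

Definition tw_str_fun : twist g (tens M X) -> tens (twist g M) X := fun t => t.
Fact tw_str_linear : linear tw_str_fun.
Proof. by []. Qed.
HB.instance Definition _ :=
  GRing.isLinear.Build A (twist g (tens M X)) (tens (twist g M) X) _
    tw_str_fun tw_str_linear.
Definition tw_str : {linear twist g (tens M X) -> tens (twist g M) X} :=
  tw_str_fun.

Lemma tw_ptens (x : X) (m : M) :
  @ptens K A (twist g M) X x m = @ptens K A M X x m.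
Proof. by apply/ffunP => i; rewrite !ffunE twistE kaut_emb. Qed.

End TwistMap.

Lemma tw_tmap_str g M X Y (t : tens (twist g (tens M X)) Y) :
  tmap (tw_str g M X) (idfun : {linear Y -> Y}) t = t.
Proof. by rewrite [RHS](@tens_sum _ _ (tens (twist g M) X) Y). Qed.

Fact tw_str_nat g M N X Y (f : {linear M -> N}) (h : {linear X -> Y})
    (m : twist g (tens M X)) :
  tw_str g N Y (tw_map g (tmap f h) m) = tmap (tw_map g f) h (tw_str g M X m).
Proof.
apply: eq_bigr => i _.
exact: (esym (tw_ptens g (h (tbasis i)) (f (m i)))).
Qed.

Fact tw_str_assoc g M X Y (m : twist g (tens (tens M X) Y)) :
  tw_str g M (vtens X Y) (tw_map g (@tassoc K A M X Y) m) =
  tassoc (tmap (tw_str g M X) (idfun : {linear Y -> Y})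
            (tw_str g (tens M X) Y m)).
Proof.
rewrite tw_tmap_str.
apply: eq_bigr => i _; apply: eq_bigr => j _.
exact: (esym (tw_ptens g (pvtens (tbasis j) (tbasis i)) (m i j))).
Qed.

Fact tw_str_unit g M (m : twist g (tens M K^o)) :
  tunit (tw_str g M K^o m) = tw_map g (@tunit K A M) m.
Proof. by apply: eq_bigr => i _; rewrite /= /kscale twistE kaut_emb. Qed.

Definition tw_fun g : modFunctor A :=
  @ModFunctor K A (twist g) (@tw_map g) (tw_str g)
    (fun _ _ => erefl) (fun _ _ _ _ _ _ => erefl)
    (fun _ _ => Bijective (fun=> erefl) (fun=> erefl))
    (@tw_str_nat g) (@tw_str_assoc g) (@tw_str_unit g).

Fact kaut_inv_zmod g : zmod_morphism (kaut_inv g).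
Proof.
move=> x y; apply: (can_inj (kaut_mapK g)).
by rewrite rmorphB !kaut_invK.
Qed.
Fact kaut_inv_monoid g : monoid_morphism (kaut_inv g).
Proof.
split=> [|x y]; apply: (can_inj (kaut_mapK g)); rewrite ?rmorph1 ?rmorphM.
  by rewrite kaut_invK.
by rewrite !kaut_invK.
Qed.
HB.instance Definition _ g :=
  GRing.isZmodMorphism.Build A A (kaut_inv g) (kaut_inv_zmod g).
HB.instance Definition _ g :=
  GRing.isMonoidMorphism.Build A A (kaut_inv g) (kaut_inv_monoid g).
Fact kaut_inv_emb g k : kaut_inv g (ka_emb A k) = ka_emb A k.
Proof. by rewrite -[in LHS](kaut_emb g) kaut_mapK. Qed.
Definition kautV g : kAut A :=
  KAut (kaut_map := kaut_inv g) (kaut_invK g) (kaut_mapK g) (kaut_inv_emb g).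

Definition tw_untwist f g M : twist g (twist f M) -> M := fun m => m.

Fact tw_cancel f g : cancel g f ->
  inhabited (modIso (mf_comp (tw_fun f) (tw_fun g)) (mf_id A)).
Proof.
move=> gf.
have l M : linear (@tw_untwist f g M).
  by move=> a m n; rewrite /tw_untwist !twistE gf.
pose L M := GRing.isLinear.Build A (twist g (twist f M)) M _ _ (l M).
pose u M : {linear twist g (twist f M) -> M} := HB.pack (@tw_untwist f g M) (L M).
split; refine (@ModIso K A (mf_comp (tw_fun f) (tw_fun g)) (mf_id A) u _ _ _) => //=.
- by move=> M; exists id.
- by move=> M X t; rewrite /u /= [RHS](tens_sum (t : tens M X)).
Qed.

Fact tw_equiv g : is_equivalence (tw_fun g).
Proof.
exists (tw_fun (kautV g)); split; apply: tw_cancel.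
  exact: kaut_invK.
exact: kaut_mapK.
Qed.

(* The autoequivalence [g], sending [M] to [M^[g]]. *)
Definition bracket g : autoEquiv A := AutoEquiv (tw_equiv g).

Definition intertwines f g (x : A) : Prop :=
  forall a, x * a = g (kaut_inv f a) * x.

Definition ups_map f g x (h : intertwines f g x) M : twist f M -> twist g M :=
  fun m => x *: (m : M).
Fact ups_map_linear f g x (h : intertwines f g x) M : linear (@ups_map f g x h M).
Proof.
move=> a m n; rewrite /ups_map !twistE scalerDr !scalerA.
by rewrite h kaut_mapK.
Qed.
HB.instance Definition _ f g x (h : intertwines f g x) M :=
  GRing.isLinear.Build A (twist f M) (twist g M) _ (@ups_map f g x h M)
    (@ups_map_linear f g x h M).

Section Upsilon.
Variables (f g : kAut A) (x : unitOf A) (h : intertwines f g (u_val x)).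
Let u M : {linear twist f M -> twist g M} := @ups_map f g (u_val x) h M.

Fact ups_bij M : bijective (u M).
Proof.
exists (fun m => u_inv x *: (m : M)) => m; rewrite /= /ups_map scalerA.
  by rewrite u_Vval scale1r.
by rewrite u_valV scale1r.
Qed.

Fact ups_nat M N (k : {linear M -> N}) m :
  u N (mf_map (tw_fun f) k m) = mf_map (tw_fun g) k (u M m).
Proof. by rewrite /= /ups_map /tw_map_fun linearZ. Qed.

Fact ups_str M X m :
  tmap (u M) (idfun : {linear X -> X}) (mf_str (tw_fun f) M X m) =
  mf_str (tw_fun g) M X (u (tens M X) m).
Proof.
rewrite [RHS](tens_sum (_ : tens (twist g M) X)).
by apply: eq_bigr => i _; rewrite /= /ups_map ffunE.
Qed.

(* Υ(x) : [f] ⇒ [g], for an invertible [x] (so that Υ(x) is an isomorphism). *)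
Definition Upsilon : modIso (bracket f) (bracket g) :=
  @ModIso K A (tw_fun f) (tw_fun g) u ups_bij ups_nat ups_str.

End Upsilon.

End Twist.

(** * Weak crossed module algebras and the 2-module Θ *)

Record weakAlgebra (K : fieldType) (H G : groupType) (X : crossedModule H G)
    (A : kAlgebra K) := WeakAlgebra {
  wa1 : G -> kAut A;
  wa2 : H -> unitOf A;
  wa3 : G -> G -> unitOf A;
  wa1M : forall f g a, wa1 (f * g)%g a = wa1 f (wa1 g a);
  wa3_central : forall f g a, wa3 f g * a = a * wa3 f g;
  wa3_1r : forall g, u_val (wa3 g 1%g) = 1;
  wa3_1l : forall g, u_val (wa3 1%g g) = 1;
  wa3_cocycle : forall f g h,
    wa1 f (u_val (wa3 g h)) * wa3 f (g * h)%g = wa3 (f * g)%g h * wa3 f g;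
  wa2M : forall x y, u_val (wa2 (x * y)%g) = wa3 (X x) (X y) * wa2 x * wa2 y;
  wa1_d : forall x a, wa1 (X x) a = wa2 x * a * u_inv (wa2 x);
  wa2_act : forall f x, u_val (wa2 (cm_act X f x)) =
    wa1 f (u_val (wa3 (X x) f^-1%g)) * wa3 f (X x * f^-1)%g
      * u_inv (wa3 f f^-1%g) * wa1 f (u_val (wa2 x))
}.

(* [A] is a [K]-algebra for the crossed module when [ω₃ = 1]. *)
Definition is_cm_algebra (K : fieldType) (H G : groupType)
    (X : crossedModule H G) (A : kAlgebra K) (w : weakAlgebra X A) : Prop :=
  forall f g, u_val (wa3 w f g) = 1.

Section Theta.
Variables (K : fieldType) (H G : groupType) (X : crossedModule H G).
Variables (A : kAlgebra K) (w : weakAlgebra X A).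

Definition theta1 (g : G) : @hom1 (twoAut A) tt tt := bracket (wa1 w g).

(* What has to hold for the data of Θ to make sense: the functors [1_{A-Mod}]
   and [ω₁ 1] on the one hand, [ω₁ f] ⋄ [ω₁ g] and [ω₁ (f g)] on the other,
   coincide as module functors, and the elements ω₃(∂x, g) ω₂(x) and ω₃(f, g)
   define transformations Υ between the appropriate functors. *)
Definition theta_id_eq : Prop := @id1 (twoAut A) tt = theta1 1%g.

Definition theta_comp_eq : Prop :=
  forall f g, comp1 (theta1 f) (theta1 g) = theta1 (f * g)%g.

Definition theta2_wd : Prop :=
  forall (f g : G) (x : tgHom X f g),
    intertwines (wa1 w f) (wa1 w g)
      (u_val (u_mul (wa3 w (X (tg_val x)) f) (wa2 w (tg_val x)))).

Definition theta_comp_wd : Prop :=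
  forall f g, intertwines (wa1 w (f * g)%g) (wa1 w (f * g)%g)
      (u_val (wa3 w f g)).

Definition theta (e1 : theta_id_eq) (eM : theta_comp_eq) (h2 : theta2_wd)
    (hc : theta_comp_wd) : pfData (twoGroup X) (twoAut A) :=
  @PfData (twoGroup X) (twoAut A) (fun=> tt)
    (fun _ _ g => theta1 g)
    (fun _ _ f g x => Upsilon (h2 f g x))
    (fun _ => eq2cell e1)
    (fun _ _ _ f g => @vcomp (twoAut A) tt tt _ _ _
       (Upsilon (hc f g)) (eq2cell (eM f g))).

End Theta.

(* Main.v *)
(* All the functors and transformations involved are the identity, or the
   multiplication by an element of [A], on underlying sets. Since twisting by
   [f] and then by [g] rescales a module exactly as [ω₁(f g)] does, the functors
   [ω₁ f] ⋄ [ω₁ g] and [ω₁(f g)] are equal, and the cells along this equality are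
   the identity on elements; each axiom of a pseudofunctor becomes an equation
   in [A]. Associativity is the cocycle condition, and vertical and horizontal
   compatibility follow from it because the image of ∂ acts trivially on the
   centre, once the formula for ω₂(ᶠy) is put in the symmetric form
   ω₃(∂(ᶠy), f) ω₂(ᶠy) = ω₃(f, ∂y) ᶠω₂(y). *)
Require Import Defs.
From HB Require Import structures.
From mathcomp Require Import all_boot all_algebra.
From mathcomp Require Import boolp.
Set Implicit Arguments.
Unset Strict Implicit.
Unset Printing Implicit Defensive.
Import GRing.Theory VectorInternalTheory.
Local Open Scope ring_scope.

(** * Strict equality of twisted module functors *)

Section StrictEquality.
Variables (K : fieldType) (A : kAlgebra K).
Implicit Types (M N P Q : lmodType A) (X : vectType K) (f g h : kAut A).

(* The underlying map of the transport along [P = Q] is [phi]: this makes sense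
   of a strict equality of modules whose carriers agree by [phi]. *)
Definition eq_along P Q (phi : P -> Q) : Prop :=
  exists e : P = Q, lin_cast e =1 phi.

Notation scaling V := (GRing.Nmodule_isLSemiModule A V).

Definition rescaled (V : zmodType) (s : scaling V) : lmodType A :=
  HB.pack (V : Type) (GRing.Zmodule.class V) s.

Definition scaling_of M : scaling M :=
  GRing.Lmodule.GRing_Nmodule_isLSemiModule_mixin (GRing.Lmodule.class M).

(** Over a fixed additive group a module is determined by its scaling: extensionality identifies the
    operations and proof irrelevance the laws, which leaves transport along [erefl]. *)
Lemma eq_along_rescaled (V : zmodType) (s t : scaling V) :
  (forall a v, a *: (v : rescaled s) = a *: (v : rescaled t) :> V) ->
  @eq_along (rescaled s) (rescaled t) (fun v => v).
Proof.
case: s t => [s s1 s2 s3 s4 s5] [t t1 t2 t3 t4 t5] st.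
have {st} e : s = t by apply: funext => a; apply: funext => v; apply: st.
case: t / e t1 t2 t3 t4 t5 => t1 t2 t3 t4 t5.
rewrite (Prop_irrelevance s1 t1) (Prop_irrelevance s2 t2).
rewrite (Prop_irrelevance s3 t3) (Prop_irrelevance s4 t4).
by rewrite (Prop_irrelevance s5 t5); exists erefl.
Qed.

Lemma eq_along_twist_comp f g h M : (forall a, h a = f (g a)) ->
  @eq_along (twist g (twist f M)) (twist h M) (fun m => m).
Proof.
move=> hfg; apply: (@eq_along_rescaled M (scaling_of (twist g (twist f M)))
  (scaling_of (twist h M))) => a v.
by rewrite ![LHS]twistE [RHS]twistE hfg.
Qed.

Lemma eq_along_twist_id f M : f =1 id -> @eq_along M (twist f M) (fun m => m).
Proof.
(* [lmodType] has no definitional eta, hence the case analysis. *)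
case: M => V c f1; pose M := GRing.Lmodule.Pack c.
apply: (@eq_along_rescaled M (scaling_of M) (scaling_of (twist f M))) => a v.
by rewrite [RHS]twistE f1.
Qed.

Lemma modFunctor_eq_along (F G : modFunctor A) (phi : forall M, F M -> G M) :
  (forall M, eq_along (phi M)) ->
  (forall M N (u : {linear M -> N}) m,
    phi N (mf_map F u m) = mf_map G u (phi M m)) ->
  (forall M X m,
    [ffun i => phi M (mf_str F M X m i)] = mf_str G M X (phi (tens M X) m)) ->
  F = G.
Proof.
case: F G phi => o m s p1 p2 p3 p4 p5 p6 [o' m' s' q1 q2 q3 q4 q5 q6] /= phi ee.
have e : o = o' by apply: funext => M; case: (ee M).
case: o' / e m' s' q1 q2 q3 q4 q5 q6 phi ee =>
  m' s' q1 q2 q3 q4 q5 q6 phi ee mm ss.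
(* Once the object maps agree, transport is along a loop, which is [erefl] by proof irrelevance. *)
have phiE M x : phi M x = x.
  by case: (ee M) => e <-; rewrite (Prop_irrelevance e erefl).
have e : m = m'.
  apply: functional_extensionality_dep => M.
  apply: functional_extensionality_dep => N.
  by apply: funext => u; apply: lin_ext => v; rewrite -[LHS]phiE mm phiE.
case: m' / e {mm} q1 q2 q4 q5 q6 => q1 q2 q4 q5 q6.
apply: modFunctor_eq => M X v; rewrite -[v in RHS]phiE -ss.
by apply/ffunP => i; rewrite ffunE phiE.
Qed.

Lemma ae_eq2_along (F G : autoEquiv A) (e : F = G) M (phi : F M -> G M) :
  eq_along phi -> ae_eq2 e M =1 phi.
Proof. by case=> e' ephi m; rewrite (ae_eq2E e e') ephi. Qed.

Lemma bracket_comp f g h : (forall a, h a = f (g a)) ->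
  ae_comp (bracket f) (bracket g) = bracket h.
Proof.
move=> hfg; apply: autoEquiv_eq.
apply: (@modFunctor_eq_along (mf_comp (tw_fun f) (tw_fun g)) (tw_fun h)
  (fun M m => m)) => //= M; first exact: eq_along_twist_comp.
by move=> X m; apply/ffunP => i; rewrite ffunE.
Qed.

Lemma bracket_id f : f =1 id -> ae_id A = bracket f.
Proof.
move=> f1; apply: autoEquiv_eq.
apply: (@modFunctor_eq_along (mf_id A) (tw_fun f) (fun M m => m)) => //= M.
  exact: eq_along_twist_id.
by move=> X m; apply/ffunP => i; rewrite ffunE.
Qed.
End StrictEquality.

(** * Units and invertible 2-morphisms *)

Lemma unitOf_idem (R : pzSemiRingType) (x : unitOf R) :
  u_val x = x * x -> u_val x = 1.
Proof.
by move=> xx; rewrite -(u_valV x) [in RHS]xx -mulrA u_valV mulr1.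
Qed.

Lemma unitOf_inv_central (R : pzSemiRingType) (x : unitOf R) :
  (forall a, u_val x * a = a * u_val x) ->
  forall a, u_inv x * a = a * u_inv x.
Proof.
move=> xC a; rewrite -[LHS]mulr1 -(u_valV x) mulrA -(mulrA _ a) -xC.
by rewrite mulrA u_Vval mul1r.
Qed.

Lemma is_iso2_eq2cell (C : twoCat) (x y : ob C) (f g : hom1 x y) (e : f = g) :
  is_iso2 (eq2cell e).
Proof. by case: g / e; exists (id2 f); rewrite vcompl. Qed.

Lemma is_iso2_vcomp (C : twoCat) (x y : ob C) (f g h : hom1 x y)
    (b : hom2 g h) (a : hom2 f g) :
  is_iso2 a -> is_iso2 b -> is_iso2 (vcomp b a).
Proof.
move=> [a' [a'a aa']] [b' [b'b bb']]; exists (vcomp a' b'); split.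
  by rewrite vcompA -(vcompA b') b'b vcompl.
by rewrite vcompA -(vcompA a) aa' vcompl.
Qed.

Lemma is_iso2_Upsilon (K : fieldType) (A : kAlgebra K) (f g : kAut A) (x : unitOf A)
    (p : intertwines f g (u_val x)) (q : intertwines g f (u_inv x)) :
  @is_iso2 (twoAut A) tt tt (bracket f) (bracket g) (Upsilon p).
Proof.
exists (@Upsilon _ _ g f (UnitOf (u_Vval x) (u_valV x)) q).
split; apply: modIso_eq => M m; rewrite /= /ups_map scalerA.
  by rewrite u_Vval scale1r.
by rewrite u_valV scale1r.
Qed.

(** * Identities in a weak algebra *)

Section WeakAlgebra.
Variables (K : fieldType) (H G : groupType) (X : crossedModule H G).
Variables (A : kAlgebra K) (w : weakAlgebra X A).
Implicit Types (f g h : G) (x y : H) (a z : A).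

Local Notation act f a := (wa1 w f a).
Local Notation w2 x := (u_val (wa2 w x)).
Local Notation w3 f g := (u_val (wa3 w f g)).

(** An injective idempotent map is the identity. *)
Lemma wa1_1 : wa1 w 1%g =1 id.
Proof.
by move=> a; apply: (can_inj (kaut_mapK (wa1 w 1%g))); rewrite -wa1M mulg1.
Qed.

Lemma wa2_1 : u_val (wa2 w 1%g) = 1.
Proof.
apply: unitOf_idem.
by rewrite -[in LHS](mulg1 1%g) wa2M cm_d1 wa3_1l mul1r.
Qed.

Lemma wa1_central f z : (forall a, z * a = a * z) ->
  forall a, act f z * a = a * act f z.
Proof.
by move=> zC a; rewrite -(kaut_invK (wa1 w f) a) -!rmorphM zC.
Qed.

Lemma wa1_d_central x z : (forall a, z * a = a * z) -> wa1 w (X x) z = z.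
Proof. by move=> zC; rewrite wa1_d -zC -mulrA u_valV mulr1. Qed.

Lemma wa1_d_wa2 x a : act (X x) a * w2 x = w2 x * a.
Proof. by rewrite wa1_d -mulrA u_Vval mulr1. Qed.

(* [∂x] acts on [A] as conjugation by ω₂(x), hence trivially on the centre, so
   the first factor of the cocycle identity loses its twist. *)
Lemma wa3_cocycle_d x g h :
  w3 g h * w3 (X x) (g * h)%g = w3 (X x * g)%g h * w3 (X x) g.
Proof.
by rewrite -wa3_cocycle wa1_d_central // => a; apply: wa3_central.
Qed.

Lemma wa2_act_comm f y :
  w3 (X (cm_act X f y)) f * w2 (cm_act X f y) = w3 f (X y) * act f (w2 y).
Proof.
have cf : (X (cm_act X f y) * f = f * X y)%g by rewrite cm_d_act mulgVK.
(* With third argument [f^-1], the cocycle identity factors ω₃(f, f⁻¹), whose inverse occurs in the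
   formula for ω₂(ᶠy). *)
have e := wa3_cocycle_d (cm_act X f y) f f^-1%g.
rewrite mulgV wa3_1r mulr1 cf in e.
rewrite wa2_act wa3_cocycle [_ * w3 f (X y)]wa3_central.
rewrite !mulrA [_ * w3 f (X y)]wa3_central -[w3 f _ * _ * _]mulrA.
rewrite [w3 _ f * _]wa3_central -e -[w3 f _ * _ * _]mulrA.
by rewrite u_valV mulr1.
Qed.

(** This is the cocycle identity at (∂y, ∂x, f), its twist removed, up to moving central factors. *)
Lemma wa_vcomp f x y :
  w3 (X (y * x)%g) f * w2 (y * x)%g =
  w3 (X y) (X x * f)%g * w2 y * (w3 (X x) f * w2 x).
Proof.
rewrite wa2M !mulrA gmulfM -wa3_cocycle_d; congr (_ * _).
rewrite [w3 (X x) f * _]wa3_central -!mulrA; congr (_ * _).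
by rewrite wa3_central.
Qed.

(** The scalar form of naturality of the composition constraints. *)
Lemma wa_hcomp f g x y :
  w3 (X x * f)%g (X y * g)%g
    * (act (X x * f)%g (w3 (X y) g * w2 y) * (w3 (X x) f * w2 x)) =
  w3 (X (x * cm_act X f y)%g) (f * g)%g * w2 (x * cm_act X f y)%g * w3 f g.
Proof.
set c := X (cm_act X f y).
have cf : (c * f = f * X y)%g by rewrite /c cm_d_act mulgVK.
have bC a : a * act f (w3 (X y) g) = act f (w3 (X y) g) * a.
  by rewrite (wa1_central _ (wa3_central w (X y) g)).
(* Moving ω₂(x) to the left of the twisted factor removes the action of ∂x; the cocycle identity at
   (∂x, f, ∂y g) then gathers the central factors. *)
transitivity (w3 (X x) (f * X y * g)%g
    * (act f (w3 (X y) g) * w3 f (X y * g)%g) * (w2 x * act f (w2 y))).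
  rewrite [w3 (X x) f * _]wa3_central [act _ _ * (w2 x * _)]mulrA wa1M wa1_d_wa2.
  rewrite -[_ * w3 (X x) f]wa3_central mulrA -wa3_cocycle_d rmorphM.
  rewrite [w2 x * (_ * _)]mulrA bC -[_ * w2 x * _]mulrA mulrA.
  by rewrite -[_ * act f _]mulrA wa3_central !mulrA !mulgA.
rewrite wa3_cocycle -cf wa2M gmulfM -/c.
(* The symmetric form [wa2_act_comm] trades ᶠω₂(y) for ω₂(ᶠy), and the cocycle identity at (c, f, g)
   produces ω₃(f, g). The remaining step is the one at (∂x, c, f g). *)
transitivity (w3 (X x) (c * f * g)%g * (w3 f g * w3 c (f * g)%g)
    * (w2 x * w2 (cm_act X f y))).
  rewrite wa3_cocycle_d -/c -!mulrA; congr (_ * (_ * _)).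
  rewrite mulrA wa3_central -mulrA -wa2_act_comm -/c.
  by rewrite mulrA -wa3_central -mulrA.
rewrite -[_ * w3 f g]wa3_central -[w3 _ c * _ * _]mulrA.
rewrite [w3 _ (f * g)%g * (w3 _ _ * _)]mulrA -wa3_cocycle_d mulgA.
by rewrite wa3_central -!mulrA.
Qed.

(** * The data of Θ and the pseudofunctor axioms *)

Lemma theta_id_eqP : theta_id_eq w.
Proof. exact/bracket_id/wa1_1. Qed.

Lemma theta_comp_eqP : theta_comp_eq w.
Proof. by move=> f g; apply/bracket_comp/wa1M. Qed.

Lemma theta2_wdP : theta2_wd w.
Proof.
move=> f g [x fg] a /=; rewrite fg wa1M kaut_invK.
by rewrite mulrA -wa3_central -!mulrA wa1_d_wa2.
Qed.

Lemma theta_comp_wdP : theta_comp_wd w.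
Proof. by move=> f g a; rewrite kaut_invK wa3_central. Qed.

Let T := theta theta_id_eqP theta_comp_eqP theta2_wdP theta_comp_wdP.

Implicit Types (M : lmodType A).

Lemma theta_unitE M (m : M) :
  (pf_unit T tt : modIso (mf_id A) (tw_fun (wa1 w 1%g))) M m = m.
Proof.
exact (@ae_eq2_along _ _ (ae_id A) (bracket (wa1 w 1%g)) theta_id_eqP M _
  (eq_along_twist_id M wa1_1) m).
Qed.

Lemma theta2E f g (a : tgHom X f g) M (m : M) :
  (@pf2 _ _ T tt tt f g a : modIso (tw_fun (wa1 w f)) (tw_fun (wa1 w g))) M m =
  (w3 (X (tg_val a)) f * w2 (tg_val a)) *: m.
Proof. by []. Qed.

Lemma theta_compE f g M (m : M) :
  (@pf_comp _ _ T tt tt tt f g :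
     modIso (mf_comp (tw_fun (wa1 w f)) (tw_fun (wa1 w g)))
            (tw_fun (wa1 w (f * g)%g))) M m = w3 f g *: m.
Proof.
exact (congr1 (fun v : M => w3 f g *: v)
  (@ae_eq2_along _ _ (ae_comp (bracket (wa1 w f)) (bracket (wa1 w g)))
     (bracket (wa1 w (f * g)%g)) (theta_comp_eqP f g) M _
     (eq_along_twist_comp M (wa1M w f g)) m)).
Qed.

Lemma theta2_eq2cellE f g (e : f = g) M (m : M) :
  (@pf2 _ _ T tt tt f g (@eq2cell (twoGroup X) tt tt f g e) :
     modIso (tw_fun (wa1 w f)) (tw_fun (wa1 w g))) M m = m.
Proof.
rewrite theta2E; have -> : tg_val (@eq2cell (twoGroup X) tt tt f g e) = 1%g.
  exact: tg_eq2cell.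
by rewrite cm_d1 wa3_1l wa2_1 mulr1 scale1r.
Qed.

Lemma theta_pseudofunctor : is_pseudofunctor T.
Proof.
constructor.
- move=> [] [] f; apply: modIso_eq => M m.
  exact (theta2_eq2cellE erefl (m : M)).
- move=> [] [] f g h b a; apply: modIso_eq => M m.
  have gE := tg_valP a.
  apply: (etrans (theta2E (tg_vcomp b a) (m : M))).
  apply: etrans _ (esym (theta2E b (_ : M))).
  change ((w3 (X (tg_val b * tg_val a)%g) f * w2 (tg_val b * tg_val a)%g)
      *: (m : M) =
    (w3 (X (tg_val b)) g * w2 (tg_val b))
      *: ((w3 (X (tg_val a)) f * w2 (tg_val a)) *: (m : M))).
  by move: (tg_val a) (tg_val b) gE => x y ->; rewrite scalerA wa_vcomp.
- move=> []; exact: is_iso2_eq2cell.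
- move=> [] [] [] f g; apply: is_iso2_vcomp; first exact: is_iso2_eq2cell.
  apply: is_iso2_Upsilon => a; rewrite kaut_invK.
  exact/unitOf_inv_central/wa3_central.
- move=> [] [] [] f f' g g' a b; apply: modIso_eq => M m.
  have f'E := tg_valP a; have g'E := tg_valP b.
  apply: etrans (theta_compE f' g' (_ : M)) _.
  apply: etrans _
    (esym (congr1 (fun v : M => _ *: v) (theta_compE f g (m : M)))).
  (* The horizontal composite evaluates the second transformation on the module twisted by ω₁(f'),
     so its scalar acts through ω₁(f'). *)
  change (w3 f' g' *: (act f' (w3 (X (tg_val b)) g * w2 (tg_val b))
      *: ((w3 (X (tg_val a)) f * w2 (tg_val a)) *: (m : M))) =
    (w3 (X (tg_val a * cm_act X f (tg_val b))%g) (f * g)%g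
      * w2 (tg_val a * cm_act X f (tg_val b))%g) *: (w3 f g *: (m : M))).
  move: (tg_val a) (tg_val b) f'E g'E => x y -> ->.
  by rewrite !scalerA -mulrA wa_hcomp.
- move=> [] [] [] [] f g h; apply: modIso_eq => M m.
  apply: etrans (theta2_eq2cellE _ (_ : M)) _.
  apply: etrans (theta_compE (f * g)%g h (_ : M)) _.
  apply: etrans (congr1 (fun v : M => _ *: v) (theta_compE f g (m : M))) _.
  apply/esym.
  apply: etrans (theta_compE f (g * h)%g (_ : M)) _.
  (* The constraint for [g], [h] is taken at the module twisted by ω₁(f): this is the source of the
     twist in the cocycle identity. *)
  apply: etrans (congr1 (fun v : M => _ *: v)
    (@theta_compE g h (twist (wa1 w f) M) _)) _.
  apply: etrans (congr1 (fun v : M => _ *: (act f (w3 g h) *: v))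
    (@ae_eq2A _ _ (theta1 w f) (theta1 w g) (theta1 w h) M m)) _.
  change (w3 f (g * h)%g *: (act f (w3 g h) *: (m : M)) =
    w3 (f * g)%g h *: (w3 f g *: (m : M))).
  by rewrite !scalerA wa3_central wa3_cocycle.
- move=> [] [] f; apply: modIso_eq => M m.
  apply: etrans
    (@theta2_eq2cellE (1 * f)%g f (@comp1l (twoGroup X) tt tt f) M _) _.
  apply: etrans (theta_compE 1%g f (_ : M)) _.
  apply: etrans (congr1 (fun v : M => _ *: v) (theta_unitE (m : M))) _.
  apply: etrans _ (esym (@ae_eq2l _ _ (theta1 w f) M m)).
  by rewrite wa3_1l scale1r.
- move=> [] [] f; apply: modIso_eq => M m.
  apply: etrans
    (@theta2_eq2cellE (f * 1)%g f (@comp1r (twoGroup X) tt tt f) M _) _.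
  apply: etrans (theta_compE f 1%g (_ : M)) _.
  apply: etrans (congr1 (fun v : M => _ *: v)
    (@theta_unitE (twist (wa1 w f) M) _)) _.
  apply: etrans _ (esym (@ae_eq2r _ _ (theta1 w f) M m)).
  by rewrite wa3_1r scale1r.
Qed.

(** When ω₃ = 1 the Υ factor of each composition constraint is scaling by 1, so only the equality
    cell remains. *)
Lemma theta_strict : is_cm_algebra w -> is_strict T.
Proof.
move=> w1; split=> [x|x y z f g]; first by exists theta_id_eqP.
exists (theta_comp_eqP f g); apply: modIso_eq => M m.
by rewrite /= /ups_map w1 scale1r.
Qed.

End WeakAlgebra.

Theorem proposition2p3 (K : fieldType) (H G : groupType)
    (X : crossedModule H G) (A : kAlgebra K) (w : weakAlgebra X A) :
  exists (e1 : theta_id_eq w) (eM : theta_comp_eq w)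
         (h2 : theta2_wd w) (hc : theta_comp_wd w),
    [/\ is_pseudofunctor (theta e1 eM h2 hc),
        is_unital (theta e1 eM h2 hc)
      & is_cm_algebra w -> is_strict (theta e1 eM h2 hc)].
Proof.
exists (theta_id_eqP w), (theta_comp_eqP w), (theta2_wdP w), (theta_comp_wdP w).
split; [exact: theta_pseudofunctor | | exact: theta_strict].
by move=> x; exists (theta_id_eqP w).
Qed.
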